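(* Let $N,k$ be positive integers with $N\ge 2k+1$ and let $m\ge 2$. Assume that all roots of $D_{k,m}(x)$ are simple, and denote them by $\phi_{m,1},\ldots,\phi_{m,k}$. Put $$\mathcal G_{m,c}(\ell)=\frac{N\left(\rho_{m,c}^{\ell}+\rho_{m,c}^{N-\ell}\right)}{\left(\rho_{m,c}-\rho_{m,c}^{-1}\right)\left(\rho_{m,c}^{N}-1\right)}.$$ Then, for $a,b\in V(K_m)$ and $0\le\ell\le N-1$, we have $$h_{C_N^k\square K_m}((0,a),(\ell,b))=\frac{2k+m-1}{2k}h_{C_N^k}(0,\ell)-\frac{2k+m-1}{2}\sum_{c=1}^{k}\frac{(m-1)\mathcal G_{m,c}(0)-(m\delta_{ab}-1)\mathcal G_{m,c}(\ell)}{D_{k,m}'(\phi_{m,c})}.$$ In particular, when $a=b$, $$h_{C_N^k\square K_m}((0,a),(\ell,a))=\frac{2k+m-1}{2k}h_{C_N^k}(0,\ell)-\frac{N(2k+m-1)(m-1)}{2}\mathcal A_{k,m}^{(N)}(\ell).$$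
   Context: All graphs are finite, simple and undirected; $\mathbb Z_N=\mathbb Z/N\mathbb Z$. $C_N^k$ is the graph with vertex set $\mathbb Z_N$ in which $x,y$ are adjacent iff $x-y\equiv\pm s\pmod N$ for some $1\le s\le k$. $K_m$ is the complete graph on $m$ vertices, $\delta_{ab}$ is the Kronecker delta. The Cartesian product $C_N^k\square G$ has vertex set $\mathbb Z_N\times V(G)$, with $(x,a)$ and $(y,b)$ adjacent iff ($a=b$ and $x,y$ are adjacent in $C_N^k$) or ($x=y$ and $a,b$ are adjacent in $G$). For a finite connected graph $Y$ and $u,v\in V(Y)$, $h_Y(u,v)$ is the expected value of $T_v=\inf\{t\ge 0: Z_t=v\}$ for the simple random walk $(Z_t)$ on $Y$ started at $u$ (each step moves to a uniformly random neighbour). For $\nu>0$, $D_{k,\nu}(x)=k+\frac{\nu}{2}-\sum_{s=1}^{k}T_s\left(\frac{x}{2}\right)$, where $T_s$ is the Chebyshev polynomial of the first kind; it has degree $k$. When its roots are simple, they are denoted $\phi_{\nu,1},\ldots,\phi_{\nu,k}\in\mathbb C$, and one chooses complex numbers with $\rho_{\nu,c}+\rho_{\nu,c}^{-1}=\phi_{\nu,c}$, $\rho_{\nu,c}=\eta_{\nu,c}^{2}$, and puts $\gamma_{\nu,c}=\eta_{\nu,c}+\eta_{\nu,c}^{-1}$. The sequence $(V_n^{(\nu,c)})_{n\ge0}$ is defined by $V_0^{(\nu,c)}=0$, $V_1^{(\nu,c)}=1$, $V_{n+2}^{(\nu,c)}=\gamma_{\nu,c}V_{n+1}^{(\nu,c)}-V_n^{(\nu,c)}$,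 and $$\mathcal A_{k,\nu}^{(N)}(\ell)=\sum_{c=1}^{k}\frac{1}{\gamma_{\nu,c}D_{k,\nu}'(\phi_{\nu,c})}\frac{V_\ell^{(\nu,c)}V_{N-\ell}^{(\nu,c)}}{V_N^{(\nu,c)}}.$$ In this statement these are used with $\nu=m$. *)

(* Defs.v *)
From HB Require Import structures.
From mathcomp Require Import all_boot all_order all_algebra.
From mathcomp Require Import all_classical all_reals all_analysis.
From mathcomp Require Export complex.

Set Implicit Arguments.
Unset Strict Implicit.
Unset Printing Implicit Defensive.

Import Order.TTheory GRing.Theory Num.Theory.

Local Open Scope classical_set_scope.
Local Open Scope ring_scope.

(* A finite simple graph is given by its adjacency relation on a finType. *)

(* For N > 2k this relation is irreflexive; it is always symmetric. The type
   'Z_N is Z/NZ only when 1 < N. *)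
Definition cycle_power (N k : nat) : rel 'Z_N :=
  [rel x y | [exists s : 'I_k.+1,
     (0 < s)%N && ((x - y == s%:R) || (x - y == - s%:R))]].

Definition complete_graph (m : nat) : rel 'I_m := [rel a b | a != b].

Definition cartesian_product (V W : finType) (e : rel V) (f : rel W) :
    rel (V * W) :=
  [rel p q | ((p.2 == q.2) && e p.1 q.1) || ((p.1 == q.1) && f p.2 q.2)].

Section random_walk.
Context {d : measure_display} {Omega : measurableType d} {R : realType}.
Variables (P : probability Omega R) (V : finType).
Implicit Types (e : rel V) (Z : nat -> Omega -> V).

Definition walk_step e (x y : V) : R := (e x y)%:R / #|e x|%:R.

(* Z is a simple random walk on e started at u. The third clause is the Markov
   property with transition probabilities walk_step, written without
   conditional probabilities. *)
Definition simple_random_walk e (u : V) Z : Prop :=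
  [/\ forall t x, measurable (Z t @^-1` [set x]),
      P (Z 0%N @^-1` [set u]) = 1%E &
      forall t (x : nat -> V) (y : V),
        P [set w | (forall i, (i <= t)%N -> Z i w = x i) /\ Z t.+1 w = y] =
        (P [set w | forall i, (i <= t)%N -> Z i w = x i]
         * (walk_step e (x t) y)%:E)%E].

(* Equal to +oo when Z never visits v. *)
Definition hitting_time Z (v : V) (w : Omega) : \bar R :=
  ereal_inf [set t%:R%:E | t in [set t : nat | Z t w = v]].

Definition expected_hitting_time Z (v : V) : \bar R :=
  (\int[P]_w hitting_time Z v w)%E.

End random_walk.

Section chebyshev.
Variable F : fieldType.

(* The pair (T_n, T_{n+1}). *)
Fixpoint chebyshevT_pair (n : nat) : {poly F} * {poly F} :=
  if n is n'.+1 then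
    let: (p, q) := chebyshevT_pair n' in (q, 2%:R *: ('X * q) - p)
  else (1, 'X).

Definition chebyshevT (n : nat) : {poly F} := (chebyshevT_pair n).1.

Definition Dpoly (k : nat) (nu : F) : {poly F} :=
  (k%:R + nu / 2%:R)%:P
  - \sum_(1 <= s < k.+1) (chebyshevT s \Po (2%:R^-1 *: 'X)).

(* The pair (V_n, V_{n+1}). *)
Fixpoint Vseq_pair (gamma : F) (n : nat) : F * F :=
  if n is n'.+1 then
    let: (p, q) := Vseq_pair gamma n' in (q, gamma * q - p)
  else (0, 1).

Definition Vseq (gamma : F) (n : nat) : F := (Vseq_pair gamma n).1.

(* Here gamma c stands for eta c + (eta c)^-1. *)
Definition Asum (N k : nat) (nu : F) (phi gamma : 'I_k -> F) (l : nat) : F :=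
  \sum_(c < k) (gamma c * (Dpoly k nu)^`().[phi c])^-1
    * (Vseq (gamma c) l * Vseq (gamma c) (N - l) / Vseq (gamma c) N).

Definition Gterm (N : nat) (rho : F) (l : nat) : F :=
  N%:R * (rho ^+ l + rho ^+ (N - l)) / ((rho - rho^-1) * (rho ^+ N - 1)).

End chebyshev.

(* Main.v *)
(** If [h] vanishes at [v] and [h x = 1 + sum_y p(x,y) h(y)] elsewhere, then
    [E_u T_v = h u], because [sum_x P(T > t, Z_t = x) h(x)] decreases by
    [P(T > t)] at each step.  So it suffices to exhibit solutions; a complex
    one is automatically real at the starting point, since its real part and
    the sum of its real and imaginary parts are both real solutions.

    Let [L = 2k - adjacency] on the cycle power.  A solution [h0] for the cycle
    power satisfies [L h0 = 2k (1 - N delta_l)].  On exponentials [rho^x] the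
    operator [L + m] acts as [2 D(rho + 1/rho)], so [S = sum_c G_c / D'(phi_c)]
    is annihilated away from the wrap-around, where the defect is
    [N sum_c U_(j-1)(phi_c / 2) / D'(phi_c)]; by Lagrange interpolation this
    vanishes for [j < k], and [(L + m) S = - 2 N delta_0].  Since the function
    [m delta_ab - 1] on [K_m] is an eigenvector of the Laplacian for [m], the
    combination of [h0] and [(m delta_ab - 1) S] in the theorem solves the
    system on the product. *)

Require Import Defs.
From mathcomp Require Import all_boot all_order all_algebra.
From mathcomp Require Import all_classical all_reals all_analysis.
From mathcomp Require Import measurable_realfun ring lra zify.

Set Implicit Arguments.
Unset Strict Implicit.
Unset Printing Implicit Defensive.

Import Order.TTheory GRing.Theory Num.Theory.
Import numFieldNormedType.Exports.

Local Open Scope ring_scope.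
Local Open Scope complex_scope.

(** * Expected hitting times from solutions of the first-step equations *)

Section hitting_time.
Context {d : measure_display} {Omega : measurableType d} {R : realType}.
Context (P : probability Omega R) (V : finType) (e : rel V) (u v : V).
Context (Z : nat -> Omega -> V) (hZ : simple_random_walk P e u Z).
Local Open Scope classical_set_scope.

Lemma measurable_walk t x : measurable (Z t @^-1` [set x]).
Proof. by have [mZ _ _] := hZ. Qed.

Lemma probability_partition t (E : set Omega) : measurable E ->
  P E = (\sum_(z : V) P (E `&` Z t @^-1` [set z]))%E.
Proof.
move=> mE; rewrite fsbig_seq ?index_enum_uniq// -measure_fin_bigcup//.
- congr (P _); apply/seteqP; split=> [w Ew|w [z _ []//]].
  by exists (Z t w) => //=; rewrite mem_index_enum.
- by move=> z1 z2 _ _ [w [[_ <-] [_ <-]]].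
- by move=> z _; apply: measurableI => //; exact: measurable_walk.
Qed.

(* Times below [j] are only required to avoid [v]; [j = 0] is a cylinder, as in
   the Markov property, and [j = t.+1] is the event that [v] is not hit by
   time [t]. *)
Definition path_event j t (x : nat -> V) : set Omega :=
  [set w | forall i, (i <= t)%N ->
     (if (i < j)%N then Z i w <> v else Z i w = x i)].

Lemma measurable_path_event j t x : measurable (path_event j t x).
Proof.
have -> : path_event j t x = \bigcap_(i in [set i | (i <= t)%N])
    [set w | if (i < j)%N then Z i w <> v else Z i w = x i] by [].
apply: bigcap_measurableType => i _.
case: (i < j)%N; last exact: measurable_walk.
by apply: (@measurableC _ _ (Z i @^-1` [set v])); exact: measurable_walk.
Qed.

(** Fixing the value at time [j] trades the last avoidance constraint for a prescribed state, so
    induction on [j] reduces avoidance events to cylinders. *)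
Lemma path_event_succ j t x z : (j <= t)%N ->
  path_event j.+1 t x `&` Z j @^-1` [set z] =
  if z == v then set0
  else path_event j t (fun i => if i == j then z else x i).
Proof.
move=> jt; case: eqP => [->|zv]; apply/seteqP; split => w //=.
- by case=> /(_ j jt); rewrite ltnSn.
- case=> wx wz i it; have := wx i it; rewrite ltnS leq_eqVlt.
  by have [->|_ //] := eqVneq i j; rewrite ltnn.
move=> wx; have := wx j jt; rewrite ltnn eqxx => wz; split => // i it.
have := wx i it; rewrite ltnS (leq_eqVlt i j).
by have [->|_ //] := eqVneq i j; rewrite ltnn wz.
Qed.

(** Induction on [j], splitting by the state at time [j]. In the inductive step [j < t], so
    overwriting [x j] leaves the last state [x t] alone and all summands share the same transition
    factor. *)
Lemma markov_path_event j t x y : (j <= t)%N ->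
  P (path_event j t x `&` Z t.+1 @^-1` [set y]) =
  (P (path_event j t x) * (walk_step e (x t) y)%:E)%E.
Proof.
have [_ _ mP] := hZ.
elim: j x => [|j IH] x jt; first exact: mP.
rewrite (probability_partition j); last first.
  by apply: measurableI; [exact: measurable_path_event|exact: measurable_walk].
rewrite (probability_partition j (measurable_path_event _ _ _)).
rewrite ge0_sume_distrl; last by move=> z _; exact: measure_ge0.
apply: eq_bigr => z _.
rewrite setIAC path_event_succ; last exact: ltnW.
case: ifP => _; first by rewrite set0I measure0 mul0e.
by rewrite IH ?(ltnW jt)// gtn_eqF.
Qed.

Definition not_hit t : set Omega := [set w | forall i, (i <= t)%N -> Z i w <> v].

Lemma not_hitE t x : not_hit t = path_event t.+1 t x.
Proof.
by apply/seteqP; split => w wx i it; have := wx i it; rewrite ltnS it.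
Qed.

Lemma measurable_not_hit t : measurable (not_hit t).
Proof. by rewrite (not_hitE t (fun=> u)); exact: measurable_path_event. Qed.

(** The law at time [t] of the walk killed on reaching [v]; its total mass is P(T > t). *)
Definition killed t x : R := fine (P (not_hit t `&` Z t @^-1` [set x])).

Let fin_numP E : measurable E -> P E \is a fin_num.
Proof. by move=> mE; rewrite fin_num_measure. Qed.

Let mNZ t x : measurable (not_hit t `&` Z t @^-1` [set x]).
Proof.
by apply: measurableI; [exact: measurable_not_hit|exact: measurable_walk].
Qed.

Lemma killed_target t : killed t v = 0.
Proof.
by rewrite /killed (not_hitE t (fun=> v)) path_event_succ// eqxx measure0.
Qed.

Lemma killed_ge0 t x : 0 <= killed t x.
Proof. by rewrite fine_ge0. Qed.

Lemma sum_killed t : (\sum_x killed t x)%:E = P (not_hit t).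
Proof.
rewrite (probability_partition t (measurable_not_hit t)) -sumEFin.
by apply: eq_bigr => x _; rewrite fineK// fin_numP.
Qed.

Lemma killed_succ t y : y != v ->
  killed t.+1 y = \sum_x killed t x * walk_step e x y.
Proof.
move=> yv; apply: EFin_inj; rewrite -sumEFin fineK ?fin_numP//.
(* Ending at [y != v] makes avoidance at time [t.+1] automatic. *)
have -> : not_hit t.+1 `&` Z t.+1 @^-1` [set y] =
    not_hit t `&` Z t.+1 @^-1` [set y].
  apply/seteqP; split => w [nh wy]; split => // i it.
    by apply: nh; exact: leqW.
  move: it; rewrite leq_eqVlt => /predU1P[->|]; last exact: nh.
  by rewrite wy; exact/eqP.
rewrite (probability_partition t); last first.
  apply: measurableI; [exact: measurable_not_hit|exact: measurable_walk].
apply: eq_bigr => x _; rewrite setIAC EFinM /killed fineK ?fin_numP//.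
rewrite (not_hitE t (fun=> x)) path_event_succ//.
case: ifP => _; first by rewrite set0I measure0 mul0e.
by rewrite markov_path_event// eqxx.
Qed.

Lemma killed0 x : x != v -> killed 0 x = (x == u)%:R.
Proof.
move=> xv; have [mZ Zu _] := hZ; rewrite /killed.
have -> : not_hit 0 `&` Z 0%N @^-1` [set x] = Z 0%N @^-1` [set x].
  apply/seteqP; split => [w []//|w wx]; split => // i; rewrite leqn0 => /eqP->.
  by rewrite wx; exact/eqP.
have [->|xu] := eqVneq x u; first by rewrite Zu.
suff -> : P (Z 0%N @^-1` [set x]) = 0%E by [].
(* The complement of the event [Z 0 = u] is null, and it contains the event [Z 0 = x]. *)
have := probability_setC P (mZ 0%N u); rewrite Zu subee// => Pu.
apply/eqP; rewrite -measure_le0 -Pu le_measure ?inE//.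
  by apply: measurableC.
by move=> w /= ->; exact/eqP.
Qed.

Lemma indic_not_hit w t0 t : Z t0 w = v -> (forall t, Z t w = v -> (t0 <= t)%N) ->
  \1_(not_hit t) w = (t < t0)%N%:R :> R.
Proof.
move=> Zt0 min_t0; rewrite indicE; congr (nat_of_bool _)%:R.
have [tt0|t0t] := ltnP t t0; last first.
  by apply/negbTE/negP => /set_mem /(_ t0 t0t).
apply/mem_set => i it /min_t0; rewrite leqNgt => /negP; apply.
exact: leq_ltn_trans tt0.
Qed.

(** Each time before the first visit contributes 1 and each later time 0; if [v] is never visited,
    all terms are 1 and both sides are infinite. *)
Lemma hitting_time_series w :
  hitting_time Z v w = (\sum_(0 <= t <oo) (\1_(not_hit t) w : R)%:E)%E.
Proof.
have ge0 t : (0 <= (\1_(not_hit t) w : R)%:E)%E by rewrite lee_fin.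
have [[t Zt]|never] := pselect (exists t, Z t w = v).
  have /ex_minnP[t0 /eqP Zt0 mint0] : exists t, Z t w == v by exists t; exact/eqP.
  have ind := indic_not_hit _ Zt0 (fun t Zt => mint0 t (introT eqP Zt)).
  have -> : hitting_time Z v w = t0%:R%:E :> \bar R.
    apply/eqP; rewrite eq_le; apply/andP; split.
      by apply: ereal_inf_lbound; exists t0.
    by apply: le_ereal_inf_tmp => _ [s /= Zs <-]; rewrite lee_fin ler_nat mint0// Zs.
  rewrite (nneseries_split 0 t0)// add0n eseries0 ?adde0; last first.
    by move=> i t0i _; rewrite ind ltnNge t0i.
  rewrite big_nat (eq_bigr (fun=> 1%:E)); last first.
    by move=> i /andP[_ it0]; rewrite ind it0.
  by rewrite -big_nat sumEFin big_const_nat subn0 iter_addr_0.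
have -> : hitting_time Z v w = +oo%E :> \bar R.
  rewrite /hitting_time (_ : [set _ | t in _] = set0) ?ereal_inf0//.
  by apply/seteqP; split => // _ [t /= Zt _]; apply: never; exists t.
symmetry; apply: eq_infty => r.
apply: le_trans (nneseries_lim_ge (Num.Def.trunc r).+1 _); last by move=> n _ _.
rewrite (eq_bigr (fun=> 1%:E)); last first.
  move=> i _; rewrite indicE mem_set// => j _ Zj; apply: never; by exists j.
rewrite sumEFin big_const_nat subn0 iter_addr_0 lee_fin.
exact/ltW/truncnS_gt.
Qed.

Lemma expected_hitting_time_series :
  expected_hitting_time P Z v = (\sum_(0 <= t <oo) (\sum_x killed t x)%:E)%E.
Proof.
rewrite /expected_hitting_time.
under eq_integral => w _ do rewrite hitting_time_series.
rewrite integral_nneseries//; last first.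
  move=> t; apply/measurable_EFinP/measurable_indic; exact: measurable_not_hit.
apply: eq_eseriesr => t _.
by rewrite integral_indic ?setIT ?sum_killed//; exact: measurable_not_hit.
Qed.

(* For the walk killed at [v], [sum_x killed n x * h x] decreases by
   [P(T > n)] at each step; being bounded by a multiple of [P(T > n)] it
   tends to [0]. Neither connectivity nor nonnegativity of [h] is needed. *)
Lemma expected_hitting_timeE (h : V -> R) : h v = 0 ->
  (forall x, x != v -> h x = 1 + \sum_y walk_step e x y * h y) ->
  expected_hitting_time P Z v = (h u)%:E.
Proof.
move=> hv hx; rewrite expected_hitting_time_series.
pose a t := \sum_x killed t x; pose M t := \sum_x killed t x * h x.
have M0 : M 0%N = h u.
  have [uv|uv] := eqVneq u v.
    rewrite uv hv /M big1// => x _; have [->|xv] := eqVneq x v.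
      by rewrite hv mulr0.
    by rewrite killed0// uv (negbTE xv) mul0r.
  rewrite /M (bigD1 u)//= killed0// eqxx mul1r big1 ?addr0// => x xu.
  have [->|xv] := eqVneq x v; first by rewrite hv mulr0.
  by rewrite killed0// (negbTE xu) mul0r.
have MS t : M t.+1 = M t - a t.
  (* Since [h v = 0], only states [y != v] count, and there [killed_succ] applies. *)
  rewrite /M (bigD1 v)//= hv mulr0 add0r.
  under eq_bigr => y yv do rewrite killed_succ// mulr_suml.
  rewrite exchange_big/= -sumrB; apply: eq_bigr => x _.
  have [->|xv] := eqVneq x v.
    by rewrite killed_target big1 ?mul0r ?subr0// => y _; rewrite !mul0r.
  rewrite [in RHS]hx// mulrDr mulr1 addrC addKr [in RHS](bigD1 v)//= hv mulr0 add0r.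
  by rewrite mulr_sumr; apply: eq_bigr => y _; rewrite mulrA.
have sum_a n : \sum_(0 <= t < n) a t = h u - M n.
  elim: n => [|n IH]; first by rewrite big_geq// M0 subrr.
  by rewrite big_nat_recr//= IH MS opprB addrA addrAC.
have a_ge0 t : 0 <= a t by apply: sumr_ge0 => x _; exact: killed_ge0.
have a_le1 t : a t <= 1.
  by rewrite -lee_fin sum_killed probability_le1//; exact: measurable_not_hit.
pose C : R := \sum_x `|h x|.
have M_le t : `|M t| <= C * a t.
  apply: le_trans (ler_norm_sum _ _ _) _; rewrite mulr_sumr.
  apply: ler_sum => x _; rewrite normrM (ger0_norm (killed_ge0 _ _)) mulrC.
  apply: ler_wpM2r; first exact: killed_ge0.
  by rewrite /C (bigD1 x)//= lerDl sumr_ge0.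
have C_ge0 : 0 <= C by apply: sumr_ge0.
(* The partial sums [h u - M n] are bounded because [M n] is at most [C * a n <= C] in modulus. So
   the series converges, its terms tend to 0, and [M] does too. *)
have cvg_a : cvgn (series a).
  apply: nondecreasing_is_cvgn.
    by apply/nondecreasing_seqP => n; rewrite /series/= big_nat_recr//= lerDl.
  exists (h u + C) => _ [n _ <-]; rewrite /series/= sum_a lerD2l.
  apply: le_trans (ler_norm _) _; rewrite normrN (le_trans (M_le n))//.
  by rewrite ler_piMr.
have cvg_M : (M n @[n --> \oo] --> (0 : R))%classic.
  apply/norm_cvg0P; apply: (@squeeze_cvgr _ _ _ _ (fun=> 0) (fun n => C * a n)).
  - by near=> n; rewrite normr_ge0 M_le.
  - exact: cvg_cst.
  - rewrite -[X in _ --> X](mulr0 C); apply: cvgMl_tmp.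
    exact: cvg_series_cvg_0.
apply: cvg_lim => //; apply: cvg_EFin; first by near=> n; rewrite sumEFin.
rewrite (_ : _ \o _ = fun n => h u - M n); last first.
  by apply/funext => n /=; rewrite sumEFin -sum_a.
rewrite -[X in _ --> X]subr0; apply: cvgB => //; exact: cvg_cst.
Unshelve. all: by end_near. Qed.

Lemma expected_hitting_time_complex (h : V -> R[i]) : h v = 0 ->
  (forall x, x != v -> h x = 1 + \sum_y (walk_step e x y)%:C * h y) ->
  expected_hitting_time P Z v \is a fin_num /\
  (fine (expected_hitting_time P Z v))%:C = h u.
Proof.
move=> hv hx.
(* A real-linear [f] with [f 1 = 1] turns [h] into a real solution. The imaginary part alone sends 1
   to 0, hence the choice of Re and Re + Im below. *)
have lin (f : R[i] -> R) : {morph f : x y / x + y} -> f 0 = 0 -> f 1 = 1 ->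
    (forall r z, f (r%:C * z) = r * f z) ->
    expected_hitting_time P Z v = (f (h u))%:E.
  move=> fD f0 f1 fM; apply: (expected_hitting_timeE (h := f \o h)) => [|x xv].
    by rewrite /= hv.
  rewrite /= hx// fD f1 (big_morph f fD f0); congr (_ + _).
  by apply: eq_bigr => y _; rewrite fM.
have ERe : expected_hitting_time P Z v = (complex.Re (h u))%:E.
  apply: lin => // [[a b] [a' b']//|r [a b]]; by rewrite /= mul0r subr0.
have : expected_hitting_time P Z v = (complex.Re (h u) + complex.Im (h u))%:E.
  apply: (lin (fun z => complex.Re z + complex.Im z)) => /=; rewrite ?addr0//.
    by move=> [a b] [a' b']; rewrite /= addrACA.
  by move=> r [a b] /=; rewrite !mul0r subr0 addr0 mulrDr.
rewrite ERe => -[ReIm]; have Im0 : complex.Im (h u) = 0 by move: ReIm; lra.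
by split => //; case: (h u) Im0 => a b /= ->.
Qed.
End hitting_time.

(** * Chebyshev-type recurrences, the polynomial D, and Lagrange interpolation *)

Section recurrences.
Variable F : numFieldType.
Implicit Types (g x nu : F) (n : nat).

Lemma VseqSS g n : Vseq g n.+2 = g * Vseq g n.+1 - Vseq g n.
Proof. by rewrite /Vseq /=; case: (Vseq_pair g n). Qed.

Lemma Vseq_closed x n : x != 0 ->
  Vseq (x + x^-1) n * (x - x^-1) = x ^+ n - x ^- n.
Proof.
move=> x0; suff [] : Vseq (x + x^-1) n * (x - x^-1) = x ^+ n - x ^- n /\
  Vseq (x + x^-1) n.+1 * (x - x^-1) = x ^+ n.+1 - x ^- n.+1 by [].
elim: n => [|n [IH1 IH2]]; first by rewrite /Vseq/= mul0r expr0 invr1 subrr mul1r !expr1.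
split => //; rewrite VseqSS mulrBl -mulrA IH1 IH2 -!exprVn !exprS; field.
by rewrite x0.
Qed.

(** The polynomial is U_(n-1)(X/2), with U the Chebyshev polynomials of the second kind. It is monic
    of degree [n - 1] for [n > 0]; the bounds are phrased so as to include the zero polynomial at
    [n = 0]. *)
Lemma Vseq_poly n : exists2 p : {poly F}, (size p <= n)%N /\ p`_n.-1 = (0 < n)%N%:R &
  forall g, p.[g] = Vseq g n.
Proof.
suff [] : (exists2 p : {poly F}, (size p <= n)%N /\ p`_n.-1 = (0 < n)%N%:R &
  forall g, p.[g] = Vseq g n) /\
  (exists2 p : {poly F}, (size p <= n.+1)%N /\ p`_n = 1 &
  forall g, p.[g] = Vseq g n.+1) by [].
elim: n => [|n [[p [sp cp] pV] [q [sq cq] qV]]].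
  split; first by exists 0; rewrite ?size_poly0 ?coef0// => g; rewrite horner0.
  by exists 1; rewrite ?size_poly1 ?coef1// => g; rewrite hornerC.
split; first by exists q.
exists ('X * q - p) => [|g]; last by rewrite !hornerE pV qV VseqSS.
split; last by rewrite coefB coefXM/= cq nth_default ?subr0// (leq_trans sp).
apply/leq_sizeP => j jn; rewrite coefB coefXM.
rewrite [p`_j]nth_default ?subr0; last by rewrite (leq_trans sp)//; lia.
by case: j jn => //= j jn; rewrite nth_default// (leq_trans sq).
Qed.

Definition halfT n : {poly F} := chebyshevT F n \Po (2%:R^-1 *: 'X).

Lemma halfT0 : halfT 0 = 1.
Proof. by rewrite /halfT /chebyshevT/= comp_polyC. Qed.

Lemma halfT1 : halfT 1 = 2%:R^-1 *: 'X.
Proof. by rewrite /halfT /chebyshevT/= comp_polyX. Qed.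

Lemma halfTSS n : halfT n.+2 = 'X * halfT n.+1 - halfT n.
Proof.
rewrite /halfT /chebyshevT /=; case: (chebyshevT_pair F n) => p q /=.
rewrite comp_polyB comp_polyZ comp_polyM comp_polyX -scalerAl scalerA.
by rewrite divff ?scale1r// pnatr_eq0.
Qed.

Lemma horner_halfT x n : x != 0 ->
  (halfT n).[x + x^-1] = (x ^+ n + x ^- n) / 2%:R.
Proof.
move=> x0; suff [] : (halfT n).[x + x^-1] = (x ^+ n + x ^- n) / 2%:R /\
  (halfT n.+1).[x + x^-1] = (x ^+ n.+1 + x ^- n.+1) / 2%:R by [].
elim: n => [|n [IH1 IH2]].
  by rewrite halfT0 halfT1 !hornerE; split; field; rewrite ?x0.
split => //; rewrite halfTSS !hornerE IH1 IH2 -!exprVn !exprS; field.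
by rewrite x0.
Qed.

Lemma size_halfT n : (size (halfT n) <= n.+1)%N.
Proof.
suff [] : (size (halfT n) <= n.+1)%N /\ (size (halfT n.+1) <= n.+2)%N by [].
elim: n => [|n [IH1 IH2]].
  rewrite halfT0 halfT1 size_poly1; split => //.
  by rewrite (leq_trans (size_scale_leq _ _))// size_polyX.
split => //; rewrite halfTSS; apply/leq_sizeP => j jn; rewrite coefB coefXM.
rewrite [(halfT n)`_j]nth_default ?subr0; last by rewrite (leq_trans IH1)//; lia.
by case: j jn => //= j jn; rewrite nth_default// (leq_trans IH2).
Qed.

Lemma coef_halfT n : (halfT n.+1)`_n.+1 = 2%:R^-1.
Proof.
elim: n => [|n IH]; first by rewrite halfT1 coefZ coefX mulr1.
by rewrite halfTSS coefB coefXM/= IH nth_default ?subr0// leqW// size_halfT.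
Qed.

(** The right side is the eigenvalue of [2k + nu] minus the sum of the shifts by 1, ..., k in both
    directions, acting on the exponential with base [x]. Roots of D thus give annihilated
    exponentials. *)
Lemma horner_Dpoly k nu x : x != 0 -> 2%:R * (Dpoly k nu).[x + x^-1] =
  (2 * k)%:R + nu - \sum_(1 <= s < k.+1) (x ^+ s + x ^- s).
Proof.
move=> x0; rewrite /Dpoly !hornerE horner_sum.
under eq_bigr => s _ do rewrite -/(halfT s) horner_halfT//.
by rewrite -mulr_suml natrM; field.
Qed.

(** Only the summand [s = k] reaches degree [k], and its leading coefficient is 2^(k-1) / 2^k. *)
Lemma Dpoly_size_lead k nu : (0 < k)%N ->
  size (Dpoly k nu) = k.+1 /\ lead_coef (Dpoly k nu) = - 2%:R^-1.
Proof.
move=> k0.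
have coefk : (Dpoly k nu)`_k = - 2%:R^-1.
  rewrite /Dpoly coefB coefC coef_sum gtn_eqF// sub0r big_nat_recr//=.
  rewrite big_nat_cond big1 ?add0r => [|s /andP[/andP[_ sk] _]]; last first.
    by rewrite -/(halfT s) nth_default// (leq_trans (size_halfT s)).
  by case: k k0 => // k _; rewrite -/(halfT k.+1) coef_halfT.
have sizek : size (Dpoly k nu) = k.+1.
  apply/eqP; rewrite eqn_leq; apply/andP; split; last first.
    rewrite ltnNge; apply/negP => /leq_sizeP/(_ k (leqnn k)) /eqP.
    by rewrite coefk oppr_eq0 invr_eq0 pnatr_eq0.
  apply: (leq_trans (size_polyD _ _)); rewrite size_polyN geq_max.
  rewrite (leq_trans (size_polyC_leq1 _))//= big_nat_cond.
  apply: (big_ind (fun p : {poly F} => (size p <= k.+1)%N)).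
  - by rewrite size_poly0.
  - by move=> p q sp sq; rewrite (leq_trans (size_polyD _ _))// geq_max sp.
  - move=> s /andP[/andP[_ sk] _]; exact: leq_trans (size_halfT s) _.
by rewrite lead_coefE sizek.
Qed.

(* On the unit circle the cosine sum is at most [2k] in modulus. *)
Lemma root_Dpoly_norm k m x : x != 0 -> (0 < m)%N ->
  root (Dpoly k m%:R) (x + x^-1) -> `|x| != 1.
Proof.
move=> x0 m0 /rootP Dx0; apply/eqP => x1.
have := horner_Dpoly k m%:R x0; rewrite Dx0 mulr0 => /esym/eqP.
rewrite subr_eq0 => /eqP /(congr1 Num.norm).
rewrite -natrD normr_nat => H.
suff : ((2 * k + m)%:R <= (2 * k)%:R :> F) by rewrite ler_nat; lia.
rewrite H (le_trans (ler_norm_sum _ _ _))//.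
apply: (@le_trans _ _ (\sum_(1 <= s < k.+1) 2%:R)); last first.
  by rewrite big_const_nat iter_addr_0 subSS subn0 -mulrnA.
apply: ler_sum => s _; rewrite (le_trans (ler_normD _ _))//.
by rewrite normfV normrX x1 expr1n invr1.
Qed.

(** Interpolate [p] at the [k] roots of [D] and compare coefficients of degree [k - 1]. The basis
    polynomials [q c] are monic of that degree, and [D'] at [phi c] is [lead_coef D] times [q c]
    there. *)
Lemma Lagrange_leading_coef k (D p : {poly F}) (phi : 'I_k -> F) :
  size D = k.+1 -> injective phi -> (forall c, root D (phi c)) ->
  (size p <= k)%N ->
  p`_k.-1 = lead_coef D * \sum_c p.[phi c] / D^`().[phi c].
Proof.
move=> sD phi_inj phi_root sp.
pose rs := [seq phi c | c <- enum 'I_k].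
have uniq_rs : uniq rs by rewrite map_inj_uniq ?enum_uniq.
have DE : D = lead_coef D *: \prod_c ('X - (phi c)%:P).
  rewrite [LHS](@all_roots_prod_XsubC _ D rs).
  - by rewrite /rs big_map big_enum.
  - by rewrite sD size_map size_enum_ord.
  - by apply/allP => _ /mapP[c _ ->].
  - by rewrite uniq_rootsE.
have lD0 : lead_coef D != 0 by rewrite lead_coef_eq0 -size_poly_eq0 sD.
pose q c := \prod_(c' | c' != c) ('X - (phi c')%:P).
have DqE c : D = lead_coef D *: (('X - (phi c)%:P) * q c).
  by rewrite [LHS]DE (bigD1 c).
have D'E c : D^`().[phi c] = lead_coef D * (q c).[phi c].
  rewrite [in LHS](DqE c) derivZ derivM derivXsubC !hornerE subrr mul0r addr0.
  by [].
have q0 c c' : c' != c -> (q c).[phi c'] = 0.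
  by move=> cc'; rewrite horner_prod (bigD1 c')//= !hornerE subrr mul0r.
have qc0 c : (q c).[phi c] != 0.
  rewrite horner_prod; apply/prodf_neq0 => c' cc'; rewrite !hornerE subr_eq0.
  by rewrite inj_eq// eq_sym.
have q_monic c : q c \is monic by apply: monic_prod => c' _; exact: monicXsubC.
have sq c : size (q c) = k.
  have := congr1 (size : {poly F} -> nat) (DqE c).
  by rewrite sD size_scale// size_monicM ?monicXsubC ?monic_neq0// size_XsubC => -[].
rewrite [in LHS](_ : p = \sum_c (p.[phi c] / (q c).[phi c]) *: q c); last first.
  apply/eqP; rewrite -subr_eq0; apply/eqP.
  apply: (@roots_geq_poly_eq0 _ _ rs) => //.
    apply/allP => _ /mapP[c _ ->]; apply/rootP; rewrite hornerD hornerN horner_sum.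
    rewrite (bigD1 c)//= big1 ?addr0 => [|c' cc']; last first.
      by rewrite hornerZ (q0 c' c) ?mulr0// eq_sym.
    by rewrite hornerZ divfK ?subrr.
  rewrite size_map size_enum_ord (leq_trans (size_polyD _ _))//.
  rewrite size_polyN geq_max sp/= (leq_trans (size_sum _ _ _))//.
  by apply/bigmax_leqP => c _; rewrite (leq_trans (size_scale_leq _ _)) ?sq.
rewrite coef_sum mulr_sumr; apply: eq_bigr => c _; rewrite coefZ D'E.
have := monicP (q_monic c); rewrite lead_coefE sq => ->.
by rewrite mulr1 invfM mulrCA mulVKf.
Qed.

(** [V_j] has degree below [k - 1] unless [j = k], when it is monic of degree [k - 1]; the factor
    [-2] inverts the leading coefficient of D. *)
Lemma sum_Vseq_Dpoly k nu (phi : 'I_k -> F) j : (0 < k)%N -> (j <= k)%N ->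
  injective phi -> (forall c, root (Dpoly k nu) (phi c)) ->
  \sum_c Vseq (phi c) j / (Dpoly k nu)^`().[phi c] = - 2%:R * (j == k)%:R.
Proof.
move=> k0 jk phi_inj phi_root; have [p [sp cp] pV] := Vseq_poly j.
have [sD lD] := Dpoly_size_lead nu k0.
have := Lagrange_leading_coef sD phi_inj phi_root (leq_trans sp jk).
rewrite lD; under eq_bigr => c _ do rewrite pV.
have -> : p`_k.-1 = (j == k)%:R.
  move: jk; rewrite leq_eqVlt => /predU1P[jk|jk].
    by rewrite -jk eqxx cp jk k0.
  by rewrite ltn_eqF// nth_default// (leq_trans sp)// -ltnS prednK.
by move=> ->; rewrite mulrA mulrNN divff ?mul1r ?pnatr_eq0.
Qed.
End recurrences.

(** * The Green function of the massive Laplacian [L + m] on half of the cycle *)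

Section green_function.
Variables (F : numFieldType) (N k m : nat).
Hypotheses (k0 : (0 < k)%N) (hN : (2 * k + 1 <= N)%N) (m0 : (0 < m)%N).
Variables (phi rho : 'I_k -> F).
Hypotheses (phi_inj : injective phi)
  (phi_root : forall c, root (Dpoly k m%:R) (phi c))
  (rho0 : forall c, rho c != 0) (rho_phi : forall c, rho c + (rho c)^-1 = phi c).

Let dD c : F := (Dpoly k m%:R)^`().[phi c].

(** This is [-2N] times the Green function of [L + m] with pole at 0, as a function of the
    representative [l]. *)
Definition green l : F := \sum_c Gterm N (rho c) l / dD c.

Let norm_rho c : `|rho c| != 1.
Proof. by apply: (@root_Dpoly_norm F k m) => //; rewrite rho_phi. Qed.

(** Equality would put [rho c] on the unit circle, which [norm_rho] excludes. With [rho_expN_neq1],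
    proved the same way, this keeps the denominators of [Gterm] nonzero. *)
Lemma rho_subV_neq0 c : rho c - (rho c)^-1 != 0.
Proof.
apply: contra (norm_rho c); rewrite subr_eq0 => /eqP rV.
have : rho c ^+ 2 = 1 by rewrite expr2 [X in _ * X]rV divff.
by move=> /(congr1 Num.norm)/eqP; rewrite normrX normr1 pexpr_eq1.
Qed.

Lemma rho_expN_neq1 c : rho c ^+ N - 1 != 0.
Proof.
apply: contra (norm_rho c); rewrite subr_eq0 => /eqP /(congr1 Num.norm)/eqP.
by rewrite normrX normr1 pexpr_eq1//; lia.
Qed.

Lemma green_sym l : (l <= N)%N -> green (N - l) = green l.
Proof.
move=> lN; apply: eq_bigr => c _; congr (_ / _).
by rewrite /Gterm subKn// [rho c ^+ l + _]addrC.
Qed.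

(* [(n - s) + (s - n)], with truncated subtractions, is [|n - s|]. The
   correction term comes from wrapping around the cycle; it vanishes for
   [s <= n]. *)
Lemma wrap_exp (x : F) n s : x != 0 -> (n + s <= N)%N ->
  (x ^+ (n + s) + x ^+ (N - (n + s)))
  + (x ^+ ((n - s) + (s - n)) + x ^+ (N - ((n - s) + (s - n)))) =
  (x ^+ n + x ^+ (N - n)) * (x ^+ s + x ^- s)
  - (x ^+ N - 1) * (x ^+ (s - n) - x ^- (s - n)).
Proof.
move=> x0 /subnKC; set r := (N - (n + s))%N => NE.
have [sn|/ltnW ns] := leqP s n.
  have [t nE] : exists t, n = (s + t)%N by exists (n - s)%N; rewrite subnKC.
  have -> : (s - n = 0)%N by lia.
  rewrite expr0 invr1 subrr mulr0 subr0 addn0 -NE.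
  have -> : (n - s = t)%N by lia.
  have -> : (n + s + r - t = s + s + r)%N by lia.
  have -> : (n + s + r - n = s + r)%N by lia.
  by rewrite nE !exprD; field; rewrite expf_neq0.
have [t sE] : exists t, s = (n + t)%N by exists (s - n)%N; rewrite subnKC.
have -> : (n - s = 0)%N by lia.
rewrite add0n -NE.
have -> : (s - n = t)%N by lia.
have -> : (n + s + r - t = n + n + r)%N by lia.
have -> : (n + s + r - n = n + t + r)%N by lia.
by rewrite sE !exprD; field; rewrite !expf_neq0.
Qed.

Lemma green_half n : (2 * n <= N)%N ->
  (2 * k + m)%:R * green n
  - \sum_(1 <= s < k.+1) (green (n + s) + green ((n - s) + (s - n)))
  = - 2%:R * N%:R * (n == 0%N)%:R.
Proof.
move=> nN; pose A c := N%:R / ((rho c - (rho c)^-1) * (rho c ^+ N - 1)) / dD c.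
have GE l : green l = \sum_c A c * (rho c ^+ l + rho c ^+ (N - l)).
  by apply: eq_bigr => c _; rewrite /Gterm /A; ring.
transitivity (N%:R * \sum_(1 <= s < k.+1)
    \sum_c Vseq (phi c) (s - n) / (Dpoly k m%:R)^`().[phi c]); last first.
  (* As [s <= k], the equation [s - n = k] forces [n = 0] and [s = k]: at most one term survives. *)
  rewrite big_nat (eq_bigr (fun s => - 2%:R * (s - n == k)%N%:R)); last first.
    by move=> s /andP[_ sk]; rewrite sum_Vseq_Dpoly//; lia.
  rewrite -big_nat -mulr_sumr mulrCA mulrA; congr (_ * _).
  rewrite big_nat_recr//= big_nat big1 ?add0r => [|s /andP[s1 sk]].
    by congr (_ %:R); congr nat_of_bool; apply/eqP/eqP; lia.
  by rewrite (_ : (s - n == k)%N = false)//; apply/eqP; lia.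
have wrap s : (s < k.+1)%N ->
    green (n + s) + green ((n - s) + (s - n)) =
    \sum_c A c * ((rho c ^+ n + rho c ^+ (N - n)) * (rho c ^+ s + rho c ^- s)
      - (rho c ^+ N - 1) * (rho c ^+ (s - n) - rho c ^- (s - n))).
  move=> sk; rewrite !GE -big_split/=; apply: eq_bigr => c _.
  by rewrite -mulrDr wrap_exp//; lia.
rewrite GE mulr_sumr.
under [X in _ - X]eq_big_nat => s /andP[_ sk] do rewrite wrap//.
rewrite [in RHS]exchange_big/= [RHS]mulr_sumr.
rewrite exchange_big/= -sumrB; apply: eq_bigr => c _.
rewrite -mulr_sumr mulrCA -mulrBr sumrB -mulr_sumr.
(* Vanishing of D at [phi c] cancels the main terms. The wrap-around correction remains, and its
   factors [rho^N - 1] and [rho - 1/rho] cancel the denominator of [A c]. *)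
have := horner_Dpoly k m%:R (rho0 c).
rewrite rho_phi (rootP (phi_root c)) mulr0 -natrD => /esym/eqP.
rewrite subr_eq0 => /eqP <-.
rewrite -mulr_sumr (eq_bigr (fun s => Vseq (phi c) (s - n) *
   (rho c - (rho c)^-1))); last first.
  by move=> s _; rewrite -rho_phi Vseq_closed.
rewrite -!mulr_suml /A -/(dD c) opprB.
set q := \sum_(1 <= i < k.+1) Vseq (phi c) (i - n).
set t := \sum_(1 <= i < k.+1) (rho c ^+ i + rho c ^- i).
set g := rho c ^+ n + _; set w := (dD c)^-1.
move: (rho_subV_neq0 c) (rho_expN_neq1 c).
by move: (rho c - _) (rho c ^+ N - 1) => u v u0 v0; field; rewrite u0 v0.
Qed.
End green_function.

(** * The Laplacian of the cycle power *)

Section cycle_power.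
Variables (N k : nat).
Hypotheses (k0 : (0 < k)%N) (hN : (2 * k + 1 <= N)%N).

Let N1 : (1 < N)%N. Proof. by lia. Qed.

Lemma natr_Zp_eq (i j : nat) : (i < N)%N -> (j < N)%N ->
  (i%:R == j%:R :> 'Z_N) = (i == j).
Proof. by move=> iN jN; rewrite -val_eqE/= !val_Zp_nat// !modn_small. Qed.

(** Since [2k < N], the residues of 1, ..., k and their opposites are pairwise distinct, so no
    neighbour is counted twice. *)
Lemma sum_cycle_power (W : nmodType) (f : 'Z_N -> W) x :
  \sum_(y | @cycle_power N k x y) f y =
  \sum_(1 <= s < k.+1) (f (x + s%:R) + f (x - s%:R)).
Proof.
pose r := [seq x + s%:R | s <- index_iota 1 k.+1] ++
          [seq x - s%:R | s <- index_iota 1 k.+1].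
have uniq_r : uniq r.
  rewrite cat_uniq; apply/and3P; split.
  - rewrite map_inj_in_uniq ?iota_uniq// => i j; rewrite !mem_index_iota.
    move=> /andP[_ ik] /andP[_ jk] /addrI /eqP; rewrite natr_Zp_eq//; lia.
  - apply/hasPn => z /mapP[i + ->]; rewrite mem_index_iota => /andP[i1 ik].
    apply/mapP => -[j]; rewrite mem_index_iota => /andP[j1 jk] /addrI /eqP.
    rewrite eq_sym -subr_eq0 opprK -natrD -[0]/(0%N%:R) natr_Zp_eq; lia.
  - rewrite map_inj_in_uniq ?iota_uniq// => i j; rewrite !mem_index_iota.
    move=> /andP[_ ik] /andP[_ jk] /addrI /oppr_inj /eqP.
    by rewrite natr_Zp_eq//; lia.
transitivity (\sum_(y <- r) f y); last by rewrite big_cat/= !big_map big_split.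
rewrite big_uniq//; apply: eq_bigl => y; rewrite mem_cat.
apply/existsP/orP => [[s /andP[s0 /orP[] /eqP xy]]|[] /mapP[s]].
- right; apply/mapP; exists (s : nat); first by rewrite mem_index_iota s0/=.
  by rewrite -xy subKr.
- left; apply/mapP; exists (s : nat); first by rewrite mem_index_iota s0/=.
  by rewrite -[s%:R]opprK -xy subKr.
- rewrite mem_index_iota => /andP[s1 sk] ->; exists (Ordinal sk) => /=.
  by rewrite s1 opprD addNKr eqxx orbT.
- rewrite mem_index_iota => /andP[s1 sk] ->; exists (Ordinal sk) => /=.
  by rewrite s1 subKr eqxx.
Qed.

Lemma sum_cycle_power_reflect (W : nmodType) (f : 'Z_N -> W) l x :
  \sum_(y | @cycle_power N k x y) f (l - y) =
  \sum_(y | @cycle_power N k (l - x) y) f y.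
Proof.
rewrite !sum_cycle_power; apply: eq_bigr => s _.
by rewrite !opprD opprK !addrA addrC.
Qed.

Lemma card_cycle_power x : #|@cycle_power N k x| = (2 * k)%N.
Proof.
rewrite -sum1_card sum_cycle_power sum_nat_const_nat; lia.
Qed.

(* By evenness only the half [2 y <= N] matters, where a step of size at most [k]
   wraps around on the left only. *)
Lemma even_cycle_power_laplacian (F : numFieldType) (S : nat -> F) (mu g : F) :
  (forall l, (l <= N)%N -> S (N - l)%N = S l) ->
  (forall n, (2 * n <= N)%N -> mu * S n
    - \sum_(1 <= s < k.+1) (S (n + s)%N + S ((n - s) + (s - n))%N)
    = g * (n == 0%N)%:R) ->
  forall y : 'Z_N, mu * S y
    - \sum_(z | @cycle_power N k y z) S z = g * (y == 0)%:R.
Proof.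
move=> S_sym S_half y.
have S_nat l : (l <= N)%N -> S (l%:R : 'Z_N) = S l.
  move=> lN; rewrite val_Zp_nat//.
  (* The endpoint [l = N] represents 0, where the symmetry of [S] is needed; it occurs in [S_opp] at
     [z = 0]. *)
  have [->|lN'] := eqVneq l N; first by rewrite modnn -(S_sym N)// subnn.
  by rewrite modn_small// ltn_neqAle lN'.
have S_opp (z : 'Z_N) : S (- z)%R = S z.
  have zN : (z < N)%N by rewrite -[X in (_ < X)%N](Zp_cast N1).
  rewrite -[z in LHS]natr_Zp -[- _]addr0 -(pchar_Zp N1) addrC -natrB 1?ltnW//.
  by rewrite S_nat ?leq_subr// S_sym// ltnW.
wlog yN : y / (2 * y <= N)%N => [half|].
  have [|yN] := leqP (2 * y)%N N; first exact: half.
  have yN1 : (y < N)%N by rewrite -[X in (_ < X)%N](Zp_cast N1).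
  have y0 : y != 0 by apply: contraTneq yN => ->.
  have := half (- y); rewrite S_opp oppr_eq0 !sum_cycle_power => <-.
    congr (_ - _); apply: eq_bigr => s _.
    by rewrite -(S_opp (- y + _)) -(S_opp (- y - _)) !opprD !opprK addrC.
  have -> : (- y : 'Z_N) = (N - y)%:R.
    by rewrite natrB 1?ltnW// pchar_Zp// natr_Zp sub0r.
  by rewrite val_Zp_nat// modn_small; lia.
rewrite sum_cycle_power -[in RHS](natr_Zp y) -[0 in RHS]/(0%N%:R) natr_Zp_eq; try lia.
rewrite -S_half//; congr (_ - _).
apply: eq_big_nat => s /andP[_ sk]; congr (_ + _).
  by rewrite -[y in LHS]natr_Zp -natrD S_nat//; lia.
have [sy|/ltnW ys] := leqP s y.
  by rewrite -[y in LHS]natr_Zp -natrB// S_nat; [congr (S _)|]; lia.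
by rewrite -S_opp opprB -[y in LHS]natr_Zp -natrB// S_nat; [congr (S _)|]; lia.
Qed.

(* The maximum principle, propagated along the steps [x -> x + 1]. *)
Lemma harmonic_cycle_power_le0 (R : realFieldType) (l : 'Z_N) (h : 'Z_N -> R) :
  h l = 0 ->
  (forall x, x != l ->
     (2 * k)%:R * h x - \sum_(y | @cycle_power N k x y) h y = 0) ->
  forall x, h x <= 0.
Proof.
move=> hl hx x; rewrite leNgt; apply/negP => hx0.
have [x0 _ max'] := @arg_maxP _ _ _ x predT h isT.
have max z : h z <= h x0 by exact: max' z isT.
have h0 : 0 < h x0 by apply: lt_le_trans hx0 _; exact: max.
have step z : h z = h x0 -> h (z + 1) = h x0.
  move=> hz; have zl : z != l by apply: contraTneq h0 => zl; rewrite -hz zl hl ltxx.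
  have := hx z zl; rewrite sum_cycle_power hz.
  rewrite (big_ltn (_ : (1 < k.+1)%N))// => sum0.
  (* All neighbours other than [z + 1] are at most the maximum, so harmonicity at [z] forces the
     value at [z + 1] up to it. *)
  have le_rest : \sum_(2 <= s < k.+1) (h (z + s%:R) + h (z - s%:R)) <=
      (2 * k.-1)%:R * h x0.
    apply: le_trans (ler_sum _ (fun s _ => lerD (max (z + s%:R)) (max (z - s%:R)))) _.
    by rewrite big_const_nat iter_addr_0 -mulr2n -mulrnA mulr_natl subSS subn1.
  have le1 := max (z - 1); have le2 := max (z + 1).
  apply/eqP; rewrite eq_le le2/=.
  have kE : (2 * k)%:R = 2 + (2 * k.-1)%:R :> R by rewrite -natrD -mulnS prednK.
  by move: sum0 le_rest le1; rewrite kE; nra.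
have all_max n : h (x0 + n%:R) = h x0.
  by elim: n => [|n IH]; rewrite ?addr0// -natr1 addrA step.
by move: h0; rewrite -(all_max (l - x0)%R) natr_Zp addrC subrK hl ltxx.
Qed.

(** The maximum principle gives uniqueness for the Dirichlet problem, hence existence by finite
    dimension. The value at [l] is then forced, because a Laplacian sums to zero over the group. *)
Lemma exists_cycle_power_hitting (R : realFieldType) (l : 'Z_N) :
  exists2 h : 'Z_N -> R, h l = 0 &
  forall x, (2 * k)%:R * h x - \sum_(y | @cycle_power N k x y) h y
    = (2 * k)%:R * (1 - N%:R * (x == l)%:R).
Proof.
pose L (h : 'Z_N -> R) x := (2 * k)%:R * h x - \sum_(y | @cycle_power N k x y) h y.
(* Row [l] imposes the boundary value; every other row is a row of the Laplacian. *)
pose A : 'M[R]_((Zp_trunc N).+2) := \matrix_(i, j)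
  if i == l then (j == l)%:R
  else (2 * k)%:R * (j == i)%:R - (@cycle_power N k i j)%:R.
have AE (v : 'rV[R]_((Zp_trunc N).+2)) i :
    (v *m A^T) 0 i = if i == l then v 0 l else L (v 0) i.
  rewrite mxE; under eq_bigr => j _ do rewrite !mxE; case: ifP => _.
    rewrite (bigD1 l)//= eqxx mulr1 big1 ?addr0// => j /negbTE->.
    by rewrite mulr0.
  under eq_bigr => j _ do rewrite mulrBr; rewrite sumrB; congr (_ - _).
    rewrite (bigD1 i)//= eqxx mulr1 mulrC big1 ?addr0// => j /negbTE->.
    by rewrite !mulr0.
  by rewrite [RHS]big_mkcond/=; apply: eq_bigr => j _; case: ifP; rewrite ?mulr1 ?mulr0.
have A_free : row_free A^T.
  apply: inj_row_free => v vA.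
  have vl : v 0 l = 0 by have := AE v l; rewrite eqxx vA mxE.
  have vL x : x != l -> L (v 0) x = 0.
    by move=> xl; have := AE v x; rewrite (negbTE xl) vA mxE.
  apply/rowP => x; rewrite mxE; apply/eqP; rewrite eq_le; apply/andP; split.
    exact: (harmonic_cycle_power_le0 vl vL).
  rewrite -oppr_le0; apply: (harmonic_cycle_power_le0 (l := l) (h := fun x => - v 0 x)).
    by rewrite vl oppr0.
  by move=> y yl; rewrite mulrN sumrN -opprD -/(L (v 0) y) vL// oppr0.
rewrite row_free_unit in A_free.
pose v := (\row_i if i == l then 0 else (2 * k)%:R) *m invmx A^T.
have vA i : (if i == l then v 0 l else L (v 0) i) =
    if i == l then 0 else (2 * k)%:R.
  by rewrite -AE mulmxKV// mxE.
have vl : v 0 l = 0 by have := vA l; rewrite eqxx.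
have vL x : x != l -> L (v 0) x = (2 * k)%:R.
  by move=> /negbTE xl; have := vA x; rewrite xl.
exists (v 0) => // x; have [->|xl] := eqVneq x l; last first.
  by rewrite -/(L (v 0) x) vL// mulr0 subr0 mulr1.
have shift s : \sum_x (v 0 (x + s%:R) + v 0 (x - s%:R)) = (\sum_x v 0 x) *+ 2.
  rewrite big_split mulr2n; congr (_ + _).
    by rewrite [RHS](reindex_inj (addIr s%:R)).
  by rewrite [RHS](reindex_inj (addIr (- s%:R))).
have sumL : \sum_x L (v 0) x = 0.
  rewrite sumrB -mulr_sumr (eq_bigr _ (fun x _ => sum_cycle_power (v 0) x)).
  rewrite exchange_big/=; under [X in _ - X]eq_bigr => s _ do rewrite shift.
  by rewrite big_const_nat iter_addr_0 subSS subn0 -mulrnA mulr_natl subrr.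
have := sumL; rewrite (bigD1 l)//= (eq_bigr (fun=> (2 * k)%:R)) => [|y]; last exact: vL.
have card_N : #|'Z_N| = N by rewrite card_ord Zp_cast.
rewrite sumr_const cardC1 card_N => /eqP; rewrite addr_eq0 => /eqP.
rewrite /L => ->; rewrite mulr1 -[in RHS](ltn_predK N1) -natr1.
by rewrite -mulr_natr; ring.
Qed.
End cycle_power.

(** The numerator [1 + rho^N - rho^l - rho^(N-l)] factors as [(1 - rho^l)(1 - rho^(N-l))].
    Extracting powers of [eta] turns each factor, and [rho^N - 1], into a closed form of [Vseq]. *)
Lemma Gterm_sub_Vseq (F : numFieldType) N l (rho eta gamma : F) :
  rho != 0 -> rho = eta ^+ 2 -> gamma = eta + eta^-1 -> rho - rho^-1 != 0 ->
  rho ^+ N - 1 != 0 -> (l <= N)%N ->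
  Gterm N rho 0 - Gterm N rho l =
  N%:R * (gamma^-1 * (Vseq gamma l * Vseq gamma (N - l) / Vseq gamma N)).
Proof.
move=> rho0 rhoE gammaE u0 v0 lN.
have eta0 : eta != 0 by apply: contra_neq rho0 => eta0; rewrite rhoE eta0 expr0n.
have uE : rho - rho^-1 = gamma * (eta - eta^-1).
  by rewrite rhoE gammaE; field.
have [gamma0 w0] : gamma != 0 /\ eta - eta^-1 != 0.
  by apply/andP; rewrite -negb_or -mulf_eq0 -uE.
have VE n : Vseq gamma n = (eta ^+ n - eta ^- n) / (eta - eta^-1).
  by rewrite gammaE -(Vseq_closed n eta0) mulfK.
rewrite /Gterm expr0 subn0 uE !VE; move: v0.
have -> : rho ^+ N = (eta ^+ l * eta ^+ (N - l)) ^+ 2.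
  by rewrite -exprD subnKC// rhoE exprAC.
have -> : eta ^+ N = eta ^+ l * eta ^+ (N - l) by rewrite -exprD subnKC.
rewrite rhoE -!exprM ![(2 * _)%N]mulnC !exprM.
have := expf_neq0 l eta0; have := expf_neq0 (N - l) eta0.
move: (eta ^+ l) (eta ^+ (N - l)) (eta - eta^-1) w0 => p q w w0 q0 p0 v0.
by field; rewrite w0 q0 p0 gamma0 -expr2 v0.
Qed.

(** * Hitting times on regular graphs and on the product with a complete graph *)

Section hitting_times.
Variable R : realType.

Lemma regular_hitting (V : finType) (e : rel V) D (v : V) (h : V -> R[i]) :
  (0 < D)%N -> (forall x, #|e x| = D) ->
  (forall x, x != v -> D%:R * h x - \sum_(y | e x y) h y = D%:R) ->
  forall x, x != v -> h x = 1 + \sum_y (walk_step e x y)%:C * h y.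
Proof.
move=> D0 reg hD x xv.
have D0' : D%:R != 0 :> R[i] by rewrite pnatr_eq0 -lt0n.
have -> : \sum_y (walk_step e x y)%:C * h y = D%:R^-1 * \sum_(y | e x y) h y.
  rewrite mulr_sumr [RHS]big_mkcond; apply: eq_bigr => y _ /=.
  rewrite /walk_step reg fmorph_div !rmorph_nat.
  by case: (e x y); rewrite ?mul0r// mul1r.
apply: (mulfI D0'); rewrite mulrDr mulr1 mulVKf// -[X in X + _](hD x xv).
by rewrite subrK.
Qed.

(** Irreflexivity of [f] separates the two kinds of edges: those preserving the second coordinate
    come from [e] only. *)
Lemma sum_cartesian_product (W : nmodType) (V U : finType) (e : rel V)
    (f : rel U) (F : V * U -> W) x a : irreflexive f ->
  \sum_(q | cartesian_product e f (x, a) q) F q =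
  \sum_(y | e x y) F (y, a) + \sum_(b | f a b) F (x, b).
Proof.
move=> irr; rewrite (bigID (fun q => a == q.2))/=; congr (_ + _).
  transitivity (\sum_(y | e x y) \sum_(b | a == b) F (y, b)).
    rewrite pair_big_dep/=; apply: eq_big => [[y b]|[y b] _ //] /=.
    rewrite /cartesian_product/=.
    by case: eqP => [<-|]; rewrite ?(irr, andbF, andbT, orbF).
  by apply: eq_bigr => y _; rewrite (big_pred1 a).
transitivity (\sum_(y | x == y) \sum_(b | f a b) F (y, b)).
  rewrite pair_big_dep/=; apply: eq_big => [[y b]|[y b] _ //] /=.
  rewrite /cartesian_product/=.
  by case: (a =P b) => [<-|]; rewrite ?(irr, andbF, andbT).
by rewrite (big_pred1 x).
Qed.

Lemma sum_complete_graph (W : zmodType) m (F : 'I_m -> W) a :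
  \sum_(b | @complete_graph m a b) F b = \sum_b F b - F a.
Proof.
rewrite [in RHS](bigD1 a)//= [RHS]addrC addKr; apply: eq_bigl => b.
by rewrite /complete_graph/= eq_sym.
Qed.

Lemma card_product_graph N k m (p : 'Z_N * 'I_m) : (0 < k)%N ->
  (2 * k + 1 <= N)%N -> (0 < m)%N ->
  #|cartesian_product (@cycle_power N k) (@complete_graph m) p| =
  (2 * k + m - 1)%N.
Proof.
move=> k0 hN m0; case: p => x a; rewrite -sum1_card sum_cartesian_product.
  rewrite sum1_card card_cycle_power//.
  rewrite (_ : \sum_(b | _) 1 = #|predC1 a|)%N.
    by rewrite cardC1 card_ord; lia.
  by rewrite -sum1_card; apply: eq_bigl => b; rewrite inE eq_sym.
by move=> b; rewrite /complete_graph/= eqxx.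
Qed.

Lemma product_laplacian N k m (k0 : (0 < k)%N) (hN : (2 * k + 1 <= N)%N)
    (m0 : (0 < m)%N) (l : 'Z_N) (b : 'I_m) (h0 S : 'Z_N -> R[i]) (S0 : R[i]) :
  let d : R[i] := (2 * k + m - 1)%:R in
  let H (p : 'Z_N * 'I_m) := d / (2 * k)%:R * h0 p.1
    - d / 2%:R * ((m%:R - 1) * S0 - (m%:R * (p.2 == b)%:R - 1) * S p.1) in
  (forall x, (2 * k)%:R * h0 x - \sum_(y | @cycle_power N k x y) h0 y
    = (2 * k)%:R * (1 - N%:R * (x == l)%:R)) ->
  (forall x, (2 * k + m)%:R * S x - \sum_(y | @cycle_power N k x y) S y
    = - 2%:R * N%:R * (x == l)%:R) ->
  forall p, p != (l, b) ->
    d * H p - \sum_(q | cartesian_product (@cycle_power N k)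
                          (@complete_graph m) p q) H q = d.
Proof.
move=> d H h0E SE [x a] xa; rewrite sum_cartesian_product; last first.
  by move=> c; rewrite /complete_graph/= eqxx.
rewrite sum_complete_graph.
set hN0 := \sum_(y | @cycle_power N k x y) h0 y.
set SN := \sum_(y | @cycle_power N k x y) S y.
have -> : \sum_(y | @cycle_power N k x y) H (y, a) =
    d / (2 * k)%:R * hN0 - d / 2%:R * ((m%:R - 1) * S0 * (2 * k)%:R
      - (m%:R * (a == b)%:R - 1) * SN).
  rewrite sumrB -!mulr_sumr sumrB -mulr_sumr; congr (_ - _ * (_ - _)).
    by rewrite mulr_natr -(card_cycle_power k0 hN x) -sumr_const mulr_sumr.
  by rewrite /= -mulr_sumr.
have -> : \sum_c H (x, c) =
    m%:R * (d / (2 * k)%:R * h0 x - d / 2%:R * ((m%:R - 1) * S0)).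
  have const (z : R[i]) : \sum_(c < m) z = m%:R * z.
    by rewrite sumr_const card_ord mulr_natl.
  have kronecker : \sum_(c < m) (m%:R * (c == b)%:R - 1) = 0 :> R[i].
    rewrite sumrB -mulr_sumr const (bigD1 b)//= eqxx big1 => [|c /negbTE->//].
    by rewrite addr0 subrr.
  rewrite /H/= sumrB const -mulr_sumr sumrB const -mulr_suml kronecker mul0r subr0.
  by ring.
have hNE : hN0 = (2 * k)%:R * h0 x - (2 * k)%:R * (1 - N%:R * (x == l)%:R).
  by rewrite -h0E subKr.
have SNE : SN = (2 * k + m)%:R * S x - - 2%:R * N%:R * (x == l)%:R.
  by rewrite -SE subKr.
have dE : d = (2 * k)%:R + m%:R - 1 by rewrite /d natrB ?natrD//; lia.
have nz : k%:R != 0 :> R[i] by rewrite pnatr_eq0 -lt0n.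
have xl_ab : (x == l)%:R * (a == b)%:R = 0 :> R[i].
  by move: xa; rewrite xpair_eqE -natrM mulnb => /negbTE ->.
rewrite {}hNE {}SNE /H/= {H} dE natrD natrM.
set X : R[i] := (x == l)%:R in xl_ab *; set A : R[i] := (a == b)%:R in xl_ab *.
(* The defects [-dNX] from [h0] and [-dN(mA - 1)X] from [S] add up to [-dNmXA], supported at the
   target [(l, b)]. *)
transitivity (2%:R * k%:R + m%:R - 1
  - (2%:R * k%:R + m%:R - 1) * N%:R * m%:R * (X * A)).
  by field; rewrite nz.
by rewrite xl_ab mulr0 subr0.
Qed.
End hitting_times.

Theorem proposition6p5 (R : realType) (N k m : nat)
    (k_gt0 : (0 < k)%N) (hN : (2 * k + 1 <= N)%N) (hm : (2 <= m)%N)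
    (simple_roots : forall x : R[i],
       root (Dpoly k m%:R) x -> mup x (Dpoly k m%:R) = 1%N)
    (phi rho eta gamma : 'I_k -> R[i])
    (phi_inj : injective phi)
    (phi_roots : forall x : R[i],
       root (Dpoly k m%:R) x <-> exists c, phi c = x)
    (rho_neq0 : forall c, rho c != 0)
    (rho_phi : forall c, rho c + (rho c)^-1 = phi c)
    (eta_rho : forall c, rho c = eta c ^+ 2)
    (gamma_eta : forall c, gamma c = eta c + (eta c)^-1)
    (a b : 'I_m) (l : nat) (hl : (l < N)%N)
    (* a simple random walk on the cycle power started at 0 *)
    (d1 : measure_display) (Omega1 : measurableType d1)
    (P1 : probability Omega1 R) (Z1 : nat -> Omega1 -> 'Z_N)
    (hZ1 : simple_random_walk P1 (@cycle_power N k) 0 Z1)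
    (* a simple random walk on the Cartesian product started at (0, a) *)
    (d2 : measure_display) (Omega2 : measurableType d2)
    (P2 : probability Omega2 R) (Z2 : nat -> Omega2 -> 'Z_N * 'I_m)
    (hZ2 : simple_random_walk P2
       (cartesian_product (@cycle_power N k) (@complete_graph m)) (0, a) Z2) :
  let hC : \bar R := expected_hitting_time P1 Z1 l%:R in
  let hCK : \bar R := expected_hitting_time P2 Z2 (l%:R, b) in
  let dD (c : 'I_k) : R[i] := (Dpoly k m%:R)^`().[phi c] in
  [/\ hC \is a fin_num,
      hCK \is a fin_num,
      (fine hCK)%:C =
        (2 * k + m - 1)%:R / (2 * k)%:R * (fine hC)%:C
        - (2 * k + m - 1)%:R / 2%:R
          * \sum_(c < k)
              ((m%:R - 1) * Gterm N (rho c) 0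
               - (m%:R * (a == b)%:R - 1) * Gterm N (rho c) l) / dD c
    & a = b ->
      (fine hCK)%:C =
        (2 * k + m - 1)%:R / (2 * k)%:R * (fine hC)%:C
        - N%:R * (2 * k + m - 1)%:R * (m%:R - 1) / 2%:R
          * Asum N m%:R phi gamma l].
Proof.
move=> hC hCK dD.
have m0 : (0 < m)%N by apply: leq_trans hm.
have N1 : (1 < N)%N by lia.
have phi_root c : root (Dpoly k m%:R) (phi c) by apply/phi_roots; exists c.
have d0 : (0 < 2 * k + m - 1)%N by lia.
have k2 : (0 < 2 * k)%N by rewrite muln_gt0.
pose S (z : 'Z_N) : R[i] := green N m phi rho z.
have SE z : (2 * k + m)%:R * S z - \sum_(y | @cycle_power N k z y) S y
    = - 2%:R * N%:R * (z == 0)%:R.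
  apply: even_cycle_power_laplacian => //; first exact: green_sym.
  by move=> n nN; rewrite green_half.
have [h h_l hE] := @exists_cycle_power_hitting N k k_gt0 hN R l%:R.
have hEC x : (2 * k)%:R * (h x)%:C - \sum_(y | @cycle_power N k x y) (h y)%:C
    = (2 * k)%:R * (1 - N%:R * (x == l%:R)%:R) :> R[i].
  have := congr1 (real_complex R) (hE x).
  by rewrite rmorphB !rmorphM rmorphB rmorph1 rmorphM !rmorph_nat rmorph_sum.
have [finC hCE] : hC \is a fin_num /\ (fine hC)%:C = (h 0)%:C.
  apply: (expected_hitting_time_complex hZ1 (h := fun x => (h x)%:C)).
    by rewrite h_l.
  apply: (regular_hitting k2) => [x|x /negbTE xl]; first exact: card_cycle_power.
  by rewrite hEC xl mulr0 subr0 mulr1.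
(* Reflection moves the pole from 0 to [l], and the value at the starting point 0 becomes [S l]. *)
have SlE x : (2 * k + m)%:R * S (l%:R - x)
    - \sum_(y | @cycle_power N k x y) S (l%:R - y)
    = - 2%:R * N%:R * (x == l%:R)%:R.
  have := SE (l%:R - x); rewrite subr_eq0 eq_sym => <-; congr (_ - _).
  exact: sum_cycle_power_reflect.
have [] := expected_hitting_time_complex hZ2 (v := (l%:R, b))
  (h := fun p => (2 * k + m - 1)%:R / (2 * k)%:R * (h p.1)%:C
    - (2 * k + m - 1)%:R / 2%:R * ((m%:R - 1) * green N m phi rho 0
        - (m%:R * (p.2 == b)%:R - 1) * S (l%:R - p.1))).
(* The constant [(m - 1) * green 0] was chosen to make the solution vanish at the target. *)
- by rewrite /= h_l subrr mulr0 eqxx mulr1 subrr mulr0 subrr.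
- apply: (regular_hitting d0) => [p|p pl]; first exact: card_product_graph.
  exact: (product_laplacian k_gt0 hN m0 (h0 := fun x => (h x)%:C)
    (S := fun x => S (l%:R - x))).
rewrite -/hCK /= subr0 -hCE.
have -> : S l%:R = green N m phi rho l by rewrite /S val_Zp_nat// modn_small.
move=> finCK hCKE; split => // [|ab]; rewrite hCKE.
  congr (_ - _ * _); rewrite /green !mulr_sumr -sumrB; apply: eq_bigr => c _.
  by rewrite !mulrA -mulrBl.
(* For [a = b] both coefficients equal [m - 1], leaving the differences treated by
   [Gterm_sub_Vseq]. *)
congr (_ - _); rewrite ab eqxx mulr1 -mulrBr /Asum /green -sumrB.
have -> : \sum_c (Gterm N (rho c) 0 / dD c - Gterm N (rho c) l / dD c) =
    N%:R * Asum N m%:R phi gamma l.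
  rewrite /Asum mulr_sumr; apply: eq_bigr => c _; rewrite -mulrBl.
  have u0 := rho_subV_neq0 m0 phi_root rho_neq0 rho_phi c.
  have v0 := rho_expN_neq1 k_gt0 hN m0 phi_root rho_neq0 rho_phi c.
  rewrite (Gterm_sub_Vseq _ (eta_rho c) (gamma_eta c))//; last exact: ltnW.
  by rewrite invfM; ring.
by rewrite -/(Asum N m%:R phi gamma l); ring.
Qed.
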